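(* Let $X$ be a finite and connected T$_0$-space such that there does not exist a splitting triad $(X;C,D)$ for which the inclusion of each connected component of $C$ in $X$ induces the trivial morphism between the fundamental groups. Then $\# X\geq 13$.
   Context: $\#X$ denotes the number of points of $X$. Splitting triad: if $X$ is a connected Alexandroff T$_0$-space and $C,D\subseteq X$ are non-empty subspaces such that $X=C\cup D$, the triple $(X;C,D)$ is a splitting triad if the inclusion of each connected component of $D$ in $X$ induces the trivial morphism between the fundamental groups. (Every finite space is Alexandroff, i.e. arbitrary intersections of open sets are open.) *)

(* Defs.v *)
From HB Require Import structures.
From mathcomp Require Import all_boot all_order all_algebra generic_quotient.
From mathcomp Require Import finmap.
From mathcomp Require Import all_classical all_reals all_analysis.
From mathcomp Require Import homotopy lra.
Set Implicit Arguments.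
Unset Strict Implicit.
Unset Printing Implicit Defensive.
Import Order.TTheory GRing.Theory Num.Theory.
Import numFieldNormedType.Exports.

Local Open Scope classical_set_scope.
Local Open Scope ring_scope.
Local Open Scope quotient_scope.

Definition unit_interval (R : realType) : Type :=
  set_type (`[0%R, 1%R]%classic : set R).

HB.instance Definition _ (R : realType) :=
  Topological.copy (unit_interval R) (set_type (`[0%R, 1%R]%classic : set R)).

Section unit_interval.
Context {R : realType}.
Local Notation I := (unit_interval R).

Definition ival (s : I) : R := set_val s.

Lemma ival_inj : injective ival.
Proof. exact: val_inj. Qed.

Lemma ival_bounds (s : I) : 0 <= ival s <= 1.
Proof. by have := set_valP s; rewrite /= in_itv. Qed.

Lemma ival_continuous : continuous ival.
Proof. exact: initial_continuous. Qed.

Let clamp_subproof (r : R) :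
  Num.max 0 (Num.min 1 r) \in (`[0%R, 1%R]%classic : set R).
Proof.
rewrite inE /= in_itv /=.
by rewrite le_max lexx /= ge_max ler01 ge_min lexx.
Qed.

(* Nearest-point retraction of R onto [0, 1]. *)
Definition clamp (r : R) : I :=
  exist (fun x : R => x \in (`[0%R, 1%R]%classic : set R)) _ (clamp_subproof r).

Lemma ival_clamp r : ival (clamp r) = Num.max 0 (Num.min 1 r).
Proof. by []. Qed.

Lemma clampK r : 0 <= r <= 1 -> ival (clamp r) = r.
Proof.
by case/andP=> r0 r1; rewrite ival_clamp (min_idPr r1) (max_idPr r0).
Qed.

Lemma ivalK s : clamp (ival s) = s.
Proof. by apply: ival_inj; rewrite clampK ?ival_bounds. Qed.

Lemma clamp_continuous : continuous clamp.
Proof.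
apply: continuous_comp_initial => r.
apply: (@continuous_max R R (cst 0) (fun r => Num.min 1 r)).
  exact: cvg_cst.
apply: (@continuous_min R R (cst 1) id); first exact: cvg_cst.
exact: cvg_id.
Qed.

Lemma clamp01 : clamp 0 != clamp 1.
Proof.
apply/eqP => /(congr1 ival); rewrite !clampK ?lexx ?ler01 // => /eqP.
by rewrite eq_sym oner_eq0.
Qed.

HB.instance Definition _ := isBiPointed.Build I clamp01.

Lemma ival0 : ival zero = 0.
Proof. by rewrite clampK ?lexx ?ler01. Qed.

Lemma ival1 : ival one = 1.
Proof. by rewrite clampK ?lexx ?ler01. Qed.

Lemma paste_continuous (Z X : topologicalType) (h : Z -> R) (c : R)
    (f g : Z -> X) :
    continuous h -> continuous f -> continuous g ->
    (forall z, h z = c -> f z = g z) ->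
  continuous (fun z => if h z <= c then f z else g z).
Proof.
move=> hc fc gc fg.
set k := fun z => _.
have -> : continuous k = {within setT, continuous k}.
  by apply/propext; exact: continuous_subspace_setT.
have <- : h @^-1` [set r | r <= c] `|` h @^-1` [set r | c <= r] = setT.
  by apply/seteqP; split=> // z _ /=; apply/orP; exact: le_total.
apply: withinU_continuous.
- by move/continuous_closedP: hc; apply; exact: closed_le.
- by move/continuous_closedP: hc; apply; exact: closed_ge.
- apply: (@subspace_eq_continuous _ _ _ f); last exact: continuous_subspaceT.
  by move=> z /set_mem /= hz; rewrite /k /from_subspace hz.
- apply: (@subspace_eq_continuous _ _ _ g); last exact: continuous_subspaceT.
  move=> z /set_mem /= hz; rewrite /k /from_subspace.
  by case: ifPn => // hz'; rewrite fg//; apply/eqP; rewrite eq_le hz hz'.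
Qed.

End unit_interval.

Section continuity.
Context {R : realType}.
Local Notation I := (unit_interval R).
Context {W Y Z : topologicalType}.
Implicit Types f g : W -> R.

Lemma comp_cts (k : Y -> Z) (h : W -> Y) :
  continuous k -> continuous h -> continuous (fun w => k (h w)).
Proof. by move=> ck ch w; apply: (@continuous_comp _ _ _ h k); [exact: ch|exact: ck]. Qed.

Lemma pair_cts (k : W -> Y) (h : W -> Z) :
  continuous k -> continuous h -> continuous (fun w => (k w, h w)).
Proof. by move=> ck ch w; apply: cvg_pair; [exact: ck|exact: ch]. Qed.

Lemma fst_cts : continuous (@fst Y Z).
Proof. by move=> z; exact: cvg_fst. Qed.

Lemma snd_cts : continuous (@snd Y Z).
Proof. by move=> z; exact: cvg_snd. Qed.

Lemma clamp_cts f : continuous f -> continuous (fun w => clamp (f w)).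
Proof.
move=> cf w; apply: (@continuous_comp _ R _ f clamp); first exact: cf.
exact: clamp_continuous.
Qed.

Lemma const_cts (r : R) : continuous (fun _ : W => r).
Proof. by move=> w; exact: cvg_cst. Qed.

Lemma add_cts f g :
  continuous f -> continuous g -> continuous (fun w => f w + g w).
Proof. by move=> cf cg w; apply: (@cvgD R R^o); [exact: cf|exact: cg]. Qed.

Lemma opp_cts f : continuous f -> continuous (fun w => - f w).
Proof. by move=> cf w; apply: (@cvgN R R^o); exact: cf. Qed.

Lemma mul_cts f g :
  continuous f -> continuous g -> continuous (fun w => f w * g w).
Proof. by move=> cf cg w; apply: (@cvgM R); [exact: cf|exact: cg]. Qed.

Lemma min_cts f g :
  continuous f -> continuous g -> continuous (fun w => Num.min (f w) (g w)).
Proof. by move=> cf cg w; apply: continuous_min; [exact: cf|exact: cg]. Qed.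

Lemma max_cts f g :
  continuous f -> continuous g -> continuous (fun w => Num.max (f w) (g w)).
Proof. by move=> cf cg w; apply: continuous_max; [exact: cf|exact: cg]. Qed.

End continuity.

Section continuity_square.
Context {R : realType}.
Local Notation I := (unit_interval R).

Lemma ival1_cts : continuous (fun z : I * I => ival z.1).
Proof.
by apply: (comp_cts (k := ival)); [exact: ival_continuous|exact: fst_cts].
Qed.

Lemma ival2_cts : continuous (fun z : I * I => ival z.2).
Proof.
by apply: (comp_cts (k := ival)); [exact: ival_continuous|exact: snd_cts].
Qed.

End continuity_square.

Local Ltac cts := repeat first
  [ exact: ival_continuous | exact: ival1_cts | exact: ival2_cts
  | exact: fst_cts | exact: snd_cts | exact: const_cts
  | apply: clamp_cts | apply: add_cts | apply: opp_cts | apply: mul_cts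
  | apply: min_cts | apply: max_cts | apply: pair_cts ].

Section path_homotopy.
Context {R : realType} {X : topologicalType}.
Local Notation I := (unit_interval R).

(* Homotopy relative to the endpoints: the first coordinate of H is the path
   parameter, the second one the deformation parameter. *)
Definition path_homotopic (x y : X) (p q : {path I from x to y in X}) : Prop :=
  exists H : I * I -> X, [/\ continuous H,
    forall s, H (s, zero) = p s,
    forall s, H (s, one) = q s &
    forall t, H (zero, t) = x /\ H (one, t) = y].

Lemma path_homotopic_reparam (x y : X) (p f g : {path I from x to y in X})
    (phi psi : I -> R) : continuous phi -> continuous psi ->
    phi zero = psi zero -> phi one = psi one ->
    (forall s, f s = p (clamp (phi s))) -> (forall s, g s = p (clamp (psi s))) ->
  path_homotopic f g.
Proof.
move=> cphi cpsi e0 e1 fE gE.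
exists (fun z => p (clamp ((1 - ival z.2) * phi z.1 + ival z.2 * psi z.1))).
split=> [|s|s|t] /=.
- apply: (comp_cts (k := p)); first exact: cts_fun.
  by cts; [apply: (comp_cts (k := phi))|apply: (comp_cts (k := psi))] => //;
    exact: fst_cts.
- by rewrite ival0 subr0 mul1r mul0r addr0 fE.
- by rewrite ival1 subrr mul1r mul0r add0r gE.
- rewrite e0 e1 -!mulrDl subrK !mul1r -e0 -e1 -!fE.
  by rewrite path_zero path_one.
Qed.

Lemma path_homotopic_refl (x y : X) (p : {path I from x to y in X}) :
  path_homotopic p p.
Proof.
apply: (@path_homotopic_reparam _ _ p _ _ ival ival) => //; try by cts.
all: by move=> s; rewrite ivalK.
Qed.

Lemma path_homotopic_sym (x y : X) (p q : {path I from x to y in X}) :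
  path_homotopic p q -> path_homotopic q p.
Proof.
case=> H [cH H0 H1 He].
exists (fun z => H (z.1, clamp (1 - ival z.2))); split=> [|s|s|t] /=.
- by apply: (comp_cts (k := H)) => //; cts.
- by rewrite ival0 subr0 H1.
- by rewrite ival1 subrr H0.
- by have [] := He t.
Qed.

Lemma path_homotopic_trans (x y : X) (p q r : {path I from x to y in X}) :
  path_homotopic p q -> path_homotopic q r -> path_homotopic p r.
Proof.
case=> H [cH H0 H1 He] [K [cK K0 K1 Ke]].
exists (fun z => if ival z.2 <= 2^-1 then H (z.1, clamp (2 * ival z.2))
                 else K (z.1, clamp (2 * ival z.2 - 1))); split=> [|s|s|t] /=.
- apply: (paste_continuous (h := fun z : I * I => ival z.2)).
  + by cts.
  + by apply: (comp_cts (k := H)) => //; cts.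
  + by apply: (comp_cts (k := K)) => //; cts.
  + move=> z ->; rewrite mulfV ?pnatr_eq0// subrr.
    by rewrite -[clamp 1]/one -[clamp 0]/zero H1 K0.
- by rewrite ival0 invr_ge0 ler0n mulr0 -[clamp 0]/zero H0.
- rewrite ival1 ifF; last by apply/negP; lra.
  by rewrite (_ : 2 * 1 - 1 = 1 :> R); [rewrite -[clamp 1]/one K1|lra].
- by case: ifP => _; [exact: He|exact: Ke].
Qed.

End path_homotopy.

Section path_operations.
Context {R : realType} {X : topologicalType}.
Local Notation I := (unit_interval R).

Definition path_cat (x y z : X) (p : {path I from x to y in X})
    (q : {path I from y to z in X}) : I -> X :=
  fun s => if ival s <= 2^-1 then p (clamp (2 * ival s))
           else q (clamp (2 * ival s - 1)).

Definition path_rev (x y : X) (p : {path I from x to y in X}) : I -> X :=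
  fun s => p (clamp (1 - ival s)).

Section path_cat.
Context (x y z : X) (p : {path I from x to y in X})
  (q : {path I from y to z in X}).

Let path_cat_continuous : continuous (path_cat p q).
Proof.
apply: paste_continuous.
- by cts.
- by apply: (comp_cts (k := p)); [exact: cts_fun|cts].
- by apply: (comp_cts (k := q)); [exact: cts_fun|cts].
- move=> s ->; rewrite mulfV ?pnatr_eq0// subrr.
  by rewrite -[clamp 1]/one -[clamp 0]/zero path_one path_zero.
Qed.

Let path_cat_zero : path_cat p q zero = x.
Proof.
by rewrite /path_cat ival0 invr_ge0 ler0n mulr0 -[clamp 0]/zero path_zero.
Qed.

Let path_cat_one : path_cat p q one = z.
Proof.
rewrite /path_cat ival1 ifF; last by apply/negP; lra.
by rewrite (_ : 2 * 1 - 1 = 1 :> R); [rewrite -[clamp 1]/one path_one|lra].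
Qed.

HB.instance Definition _ :=
  @isContinuous.Build _ _ (path_cat p q) path_cat_continuous.
HB.instance Definition _ :=
  @isPath.Build I X x z (path_cat p q) path_cat_zero path_cat_one.

End path_cat.

Section path_rev.
Context (x y : X) (p : {path I from x to y in X}).

Let path_rev_continuous : continuous (path_rev p).
Proof. by apply: (comp_cts (k := p)); [exact: cts_fun|cts]. Qed.

Let path_rev_zero : path_rev p zero = y.
Proof. by rewrite /path_rev ival0 subr0 -[clamp 1]/one path_one. Qed.

Let path_rev_one : path_rev p one = x.
Proof. by rewrite /path_rev ival1 subrr -[clamp 0]/zero path_zero. Qed.

HB.instance Definition _ :=
  @isContinuous.Build _ _ (path_rev p) path_rev_continuous.
HB.instance Definition _ :=
  @isPath.Build I X y x (path_rev p) path_rev_zero path_rev_one.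

End path_rev.

Lemma path_catE (x y z : X) (p : {path I from x to y in X})
    (q : {path I from y to z in X}) s :
  path_cat p q s = if ival s <= 2^-1 then p (clamp (2 * ival s))
                   else q (clamp (2 * ival s - 1)).
Proof. by []. Qed.

Lemma path_homotopic_cat (x y z : X) (p p' : {path I from x to y in X})
    (q q' : {path I from y to z in X}) :
  path_homotopic p p' -> path_homotopic q q' ->
  path_homotopic (path_cat p q) (path_cat p' q').
Proof.
case=> H [cH H0 H1 He] [K [cK K0 K1 Ke]].
exists (fun z => if ival z.1 <= 2^-1 then H (clamp (2 * ival z.1), z.2)
                 else K (clamp (2 * ival z.1 - 1), z.2)); split=> [|s|s|t] /=.
- apply: (paste_continuous (h := fun z : I * I => ival z.1)).
  + by cts.
  + by apply: (comp_cts (k := H)) => //; cts.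
  + by apply: (comp_cts (k := K)) => //; cts.
  + move=> w ->; rewrite mulfV ?pnatr_eq0// subrr.
    by rewrite -[clamp 1]/one -[clamp 0]/zero (He _).2 (Ke _).1.
- by rewrite /path_cat !H0 !K0.
- by rewrite /path_cat !H1 !K1.
- rewrite ival0 invr_ge0 ler0n mulr0 -[clamp 0]/zero (He _).1; split=> //.
  rewrite ival1 ifF; last by apply/negP; lra.
  by rewrite (_ : 2 * 1 - 1 = 1 :> R); [rewrite -[clamp 1]/one (Ke _).2|lra].
Qed.

Lemma path_homotopic_rev (x y : X) (p p' : {path I from x to y in X}) :
  path_homotopic p p' -> path_homotopic (path_rev p) (path_rev p').
Proof.
case=> H [cH H0 H1 He].
exists (fun z => H (clamp (1 - ival z.1), z.2)); split=> [|s|s|t] /=.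
- by apply: (comp_cts (k := H)) => //; cts.
- by rewrite H0.
- by rewrite H1.
- rewrite ival0 ival1 subr0 subrr -[clamp 1]/one -[clamp 0]/zero.
  by rewrite (He _).1 (He _).2.
Qed.

Lemma path_catA (x y z w : X) (p : {path I from x to y in X})
    (q : {path I from y to z in X}) (r : {path I from z to w in X}) :
  path_homotopic (path_cat p (path_cat q r)) (path_cat (path_cat p q) r).
Proof.
apply: (@path_homotopic_reparam _ _ _ _ (path_cat p (path_cat q r)) _ _ ival
  (fun s => Num.min (2 * ival s) (Num.min (ival s + 4^-1) (2^-1 * ival s + 2^-1)))).
- by cts.
- by cts.
- by rewrite ival0 mulr0 minEle ifT // le_min; apply/andP; split; lra.
- rewrite ival1 [X in Num.min _ X]minEle ifF; last by apply/negP; lra.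
  by rewrite minEle ifF; [lra|apply/negP; lra].
- by move=> s; rewrite ivalK.
- move=> s; have /andP[s0 s1] := ival_bounds s; rewrite /= path_catE [in RHS]path_catE /= !path_catE.
  case: (leP (ival s) 2^-1) => h2.
    rewrite (@clampK _ (2 * ival s)); last by apply/andP; split; lra.
    case: (leP (2 * ival s) 2^-1) => h1.
      rewrite [Num.min (2 * _) _]min_l; last by rewrite le_min; apply/andP; split; lra.
      rewrite clampK; last by apply/andP; split; lra.
      by rewrite ifT //; lra.
    rewrite (min_l (_ : ival s + 4^-1 <= _)); last by lra.
    rewrite min_r; last by lra.
    rewrite clampK; last by apply/andP; split; lra.
    rewrite ifF; last by apply/negP; lra.
    rewrite clampK; last by apply/andP; split; lra.
    rewrite ifT; last by lra.
    by congr (q (clamp _)); lra.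
  rewrite (min_r (_ : _ <= ival s + 4^-1)); last by lra.
  rewrite min_r; last by lra.
  rewrite clampK; last by apply/andP; split; lra.
  rewrite ifF; last by apply/negP; lra.
  rewrite clampK; last by apply/andP; split; lra.
  rewrite ifF; last by apply/negP; lra.
  by congr (r (clamp _)); lra.
Qed.

Lemma path_cat1p (x y : X) (p : {path I from x to y in X}) :
  path_homotopic (path_cat (cst x : {path I from x to x in X}) p) p.
Proof.
apply: (@path_homotopic_reparam _ _ _ _ p _ _
  (fun s => Num.max 0 (2 * ival s - 1)) ival).
- by cts.
- by cts.
- by rewrite ival0 maxEle ifF //; apply/negP; lra.
- by rewrite ival1 maxEle ifT; lra.
- move=> s; have /andP[s0 s1] := ival_bounds s; rewrite /= /path_cat.
  case: (leP (ival s) 2^-1) => h2; last by rewrite maxEle ifT //; lra.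
  rewrite (max_idPl _); last by lra.
  by rewrite -[clamp 0]/zero path_zero.
- by move=> s; rewrite ivalK.
Qed.

Lemma path_catp1 (x y : X) (p : {path I from x to y in X}) :
  path_homotopic (path_cat p (cst y : {path I from y to y in X})) p.
Proof.
apply: (@path_homotopic_reparam _ _ _ _ p _ _
  (fun s => Num.min (2 * ival s) 1) ival).
- by cts.
- by cts.
- by rewrite ival0 minEle ifT; lra.
- by rewrite ival1 minEle ifF //; apply/negP; lra.
- move=> s; have /andP[s0 s1] := ival_bounds s; rewrite /= /path_cat.
  case: (leP (ival s) 2^-1) => h2; first by rewrite minEle ifT //; lra.
  rewrite (min_idPr _); last by lra.
  by rewrite -[clamp 1]/one path_one.
- by move=> s; rewrite ivalK.
Qed.

Lemma path_catpV (x : X) (p : {path I from x to x in X}) :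
  path_homotopic (path_cat p (path_rev p)) (cst x : {path I from x to x in X}).
Proof.
apply: (@path_homotopic_reparam _ _ _ _ p _ _
  (fun s => Num.min (2 * ival s) (2 - 2 * ival s)) (fun=> 0)).
- by cts.
- by cts.
- by rewrite ival0 minEle ifT; lra.
- by rewrite ival1 minEle ifF; [lra|apply/negP; lra].
- move=> s; have /andP[s0 s1] := ival_bounds s; rewrite /= path_catE /= /path_rev.
  case: (leP (ival s) 2^-1) => h2; first by rewrite minEle ifT //; lra.
  rewrite minEle ifF; last by apply/negP; lra.
  rewrite clampK; last by apply/andP; split; lra.
  by congr (p (clamp _)); lra.
- by move=> s; rewrite -[clamp 0]/zero path_zero.
Qed.

Lemma path_catVp (x : X) (p : {path I from x to x in X}) :
  path_homotopic (path_cat (path_rev p) p) (cst x : {path I from x to x in X}).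
Proof.
apply: (@path_homotopic_reparam _ _ _ _ p _ _
  (fun s => Num.max (1 - 2 * ival s) (2 * ival s - 1)) (fun=> 1)).
- by cts.
- by cts.
- by rewrite ival0 maxEle ifF; [lra|apply/negP; lra].
- by rewrite ival1 maxEle ifT; lra.
- move=> s; have /andP[s0 s1] := ival_bounds s; rewrite /= path_catE /= /path_rev.
  case: (leP (ival s) 2^-1) => h2; last by rewrite maxEle ifT //; lra.
  rewrite (max_idPl _); last by lra.
  by rewrite clampK //; apply/andP; split; lra.
- by move=> s; rewrite -[clamp 1]/one path_one.
Qed.

End path_operations.

Lemma path_homotopic_comp (R : realType) (X Y : topologicalType)
    (f : continuousType X Y) (x y : X)
    (p q : {path (unit_interval R) from x to y in X}) :
  path_homotopic p q ->
  path_homotopic (f \o p : {path (unit_interval R) from f x to f y in Y})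
                 (f \o q : {path (unit_interval R) from f x to f y in Y}).
Proof.
case=> H [cH H0 H1 He]; exists (f \o H); split=> [|s|s|t] /=.
- by apply: (comp_cts (k := f)) => //; exact: cts_fun.
- by rewrite H0.
- by rewrite H1.
- by rewrite (He _).1 (He _).2.
Qed.

Section fundamental_group.
Context {R : realType} {X : topologicalType}.
Local Notation I := (unit_interval R).
Local Notation loop x := {path I from x to x in X}.

Definition loop_homotopic (x : X) (p q : loop x) : bool :=
  `[< path_homotopic p q >].

Let loop_homotopic_refl (x : X) : reflexive (@loop_homotopic x).
Proof. by move=> p; apply/asboolP; exact: path_homotopic_refl. Qed.

Let loop_homotopic_sym (x : X) : symmetric (@loop_homotopic x).
Proof.
by move=> p q; apply/asboolP/asboolP; exact: path_homotopic_sym.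
Qed.

Let loop_homotopic_trans (x : X) : transitive (@loop_homotopic x).
Proof.
move=> q p r /asboolP pq /asboolP qr; apply/asboolP.
exact: path_homotopic_trans pq qr.
Qed.

Canonical loop_homotopic_equiv (x : X) := EquivRel (@loop_homotopic x)
  (@loop_homotopic_refl x) (@loop_homotopic_sym x) (@loop_homotopic_trans x).

End fundamental_group.

Definition pi1 (R : realType) (X : topologicalType) (x : X) : Type :=
  {eq_quot (@loop_homotopic R X x)}.

HB.instance Definition _ (R : realType) (X : topologicalType) (x : X) :=
  EqQuotient.on (pi1 R x).
HB.instance Definition _ (R : realType) (X : topologicalType) (x : X) :=
  Choice.on (pi1 R x).

Section pi1_group.
Context {R : realType} {X : topologicalType} (x : X).
Local Notation I := (unit_interval R).
Local Notation loop := {path I from x to x in X}.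

Definition loop_class (p : loop) : pi1 R x := \pi p.

Lemma loop_classP (p q : loop) :
  loop_class p = loop_class q <-> path_homotopic p q.
Proof.
by split=> [/eqmodP/asboolP|pq]; [|apply/eqmodP/asboolP].
Qed.

Lemma loop_class_surj (c : pi1 R x) : loop_class (repr c) = c.
Proof. exact: reprK. Qed.

Definition pi1_one : pi1 R x := loop_class (cst x).

Definition pi1_mul (c d : pi1 R x) : pi1 R x :=
  loop_class (path_cat (repr c) (repr d)).

Definition pi1_inv (c : pi1 R x) : pi1 R x := loop_class (path_rev (repr c)).

Lemma repr_loop_class (p : loop) : path_homotopic (repr (loop_class p)) p.
Proof. by apply/loop_classP; rewrite loop_class_surj. Qed.

Lemma pi1_mul_class (p q : loop) :
  pi1_mul (loop_class p) (loop_class q) = loop_class (path_cat p q).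
Proof. by apply/loop_classP/path_homotopic_cat; exact: repr_loop_class. Qed.

Lemma pi1_inv_class (p : loop) :
  pi1_inv (loop_class p) = loop_class (path_rev p).
Proof. by apply/loop_classP/path_homotopic_rev; exact: repr_loop_class. Qed.

Let pi1_mulA : associative pi1_mul.
Proof.
move=> c d e; rewrite -(loop_class_surj c) -(loop_class_surj d).
rewrite -(loop_class_surj e) !pi1_mul_class; apply/loop_classP.
exact: path_catA.
Qed.

Let pi1_mul1 : left_id pi1_one pi1_mul.
Proof.
move=> c; rewrite -(loop_class_surj c) pi1_mul_class; apply/loop_classP.
exact: path_cat1p.
Qed.

Let pi1_1mul : right_id pi1_one pi1_mul.
Proof.
move=> c; rewrite -(loop_class_surj c) pi1_mul_class; apply/loop_classP.
exact: path_catp1.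
Qed.

Let pi1_mulV : left_inverse pi1_one pi1_inv pi1_mul.
Proof.
move=> c; rewrite -(loop_class_surj c) pi1_inv_class pi1_mul_class.
by apply/loop_classP; exact: path_catVp.
Qed.

Let pi1_Vmul : right_inverse pi1_one pi1_inv pi1_mul.
Proof.
move=> c; rewrite -(loop_class_surj c) pi1_inv_class pi1_mul_class.
by apply/loop_classP; exact: path_catpV.
Qed.

HB.instance Definition _ := isGroup.Build (pi1 R x)
  pi1_mulA pi1_mul1 pi1_1mul pi1_mulV pi1_Vmul.

End pi1_group.

Section pi1_map.
Context {R : realType} {X Y : topologicalType} (f : continuousType X Y) (x : X).
Local Notation I := (unit_interval R).

Definition pi1_map (c : pi1 R x) : pi1 R (f x) :=
  loop_class (f \o (repr c : {path I from x to x in X})).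

Lemma pi1_map_class (p : {path I from x to x in X}) :
  pi1_map (loop_class p) = loop_class (f \o p).
Proof. by apply/loop_classP/path_homotopic_comp; exact: repr_loop_class. Qed.

Let pi1_map_morphism : monoid.monoid_morphism pi1_map.
Proof.
split=> [|c d].
  rewrite [1%g]/(pi1_one x) pi1_map_class.
  by congr loop_class; apply/path_eqP.
rewrite -(loop_class_surj c) -(loop_class_surj d).
rewrite [LHS](congr1 pi1_map (pi1_mul_class _ _)) !pi1_map_class.
rewrite [RHS]pi1_mul_class.
by congr loop_class; apply/path_eqP => s /=; rewrite !path_catE /=; case: ifP.
Qed.

HB.instance Definition _ :=
  isUMagmaMorphism.Build (pi1 R x) (pi1 R (f x)) pi1_map pi1_map_morphism.

End pi1_map.

Section inclusion.
Context {X : topologicalType} (A : set X).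

Definition inclusion (a : A) : X := set_val a.

Let inclusion_continuous : continuous inclusion.
Proof. exact: initial_continuous. Qed.

HB.instance Definition _ :=
  @isContinuous.Build A X inclusion inclusion_continuous.

End inclusion.

(* A base point is needed to speak of the fundamental group of A; the
   condition is required at every base point a of A. Here A is the subtype of
   X with the subspace topology, so pi1 R a is built from loops inside A. *)
Definition inclusion_pi1_trivial (R : realType) (X : topologicalType)
    (A : set X) : Prop :=
  forall (a : A) (c : pi1 R a), pi1_map (@inclusion X A) c = 1%g.

Definition components_pi1_trivial (R : realType) (X : topologicalType)
    (A : set X) : Prop :=
  forall x, A x -> inclusion_pi1_trivial R (connected_component A x).

Definition alexandroff_space (X : topologicalType) : Prop :=
  forall F : set (set X), F `<=` open -> open (\bigcap_(U in F) U).

(* `connected set0` holds, but a connected space is nonempty. *)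
Definition connected_space (X : topologicalType) : Prop :=
  [set: X] !=set0 /\ connected [set: X].

Record splitting_triad (R : realType) (X : topologicalType) (C D : set X) :
    Prop := SplittingTriad {
  triad_alexandroff : alexandroff_space X;
  triad_kolmogorov : kolmogorov_space X;
  triad_connected : connected_space X;
  triad_nonempty_left : C !=set0;
  triad_nonempty_right : D !=set0;
  triad_cover : [set: X] = C `|` D;
  triad_trivial : components_pi1_trivial R D }.

(* Main.v *)
Require Import Defs.
From HB Require Import structures.
From mathcomp Require Import all_boot all_order all_algebra finmap.
From mathcomp Require Import all_classical all_reals all_analysis.
From mathcomp Require Import homotopy zify lra.
Set Implicit Arguments.
Unset Strict Implicit.
Unset Printing Implicit Defensive.
Import Order.TTheory GRing.Theory Num.Theory.
Import numFieldNormedType.Exports.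

(** Order a finite T0 space X by x <= y when every open set containing y
contains x.  The canonical path from x to y for x <= y stays at x until it
jumps to y at time 1.  Transporting these paths to a base point x0 gives a
cocycle g on the order with values in the fundamental group: g x y * g y z =
g x z.  A set A of points is called flat when g is a coboundary on it, that is
f x * g x y = f y for some f and all x <= y in A.  A path can be cut into
pieces, each moving inside the minimal neighbourhood of one of its points, so
that a loop inside a flat set is null-homotopic in X ([hol_flat]).  Hence two
flat sets covering X form a splitting triad of the excluded kind
([flat_components_trivial]), and it remains to cover every finite poset with
a cocycle and at most 12 points by two flat sets ([small_splits]).

This is an induction on the number of points.  A set with a largest element is
flat, and remains so when minimal points are added ([flat_cone]); dually for
smallest elements.  If x <= y and every point above x is comparable to y, then
x can join the part containing y, so a cover of X \ x extends to X
([splits_dominated]).  This applies when only one maximal point lies above x.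
One may thus assume that each of the b points which are neither maximal nor
minimal (the middle points) lies below at least two of the m maximal points
and above at least two of the n minimal points.  If some maximal y and minimal
z are such that every middle point is below y or above z, then the points
below y with all minimal points, and the points above z with all maximal
points, form the cover ([splits_two_cones]).

Otherwise every pair (y, z) is missed by a middle point, and double counting
gives b (m - 2) >= m s, where s = 3 if n = 3 and s = 2 if n > 3, together with
the dual inequality.  With b + m + n <= 12 the only solution is
b = m = n = 4, with equality in all estimates ([incidence_bound],
[tight_count]).  In that case two comparable middle points have the same
maximal points above them, and [splits_dominated] applies again; and if the
middle points are pairwise incomparable, they fall into two pairs, one with at
most one common maximal upper bound, one with at most one common minimal lower
bound ([good_pairing]).  The first pair with the maximal points, and the second
with the minimal points, are two flat sets ([flat_two_stars]). *)

(** * Double counting *)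

(* Finite-set lemmas take precedence over their classical namesakes. *)
Import boot.fintype boot.finset.

Section Counting.
Variable T : finType.
Implicit Types (A B M N : {set T}) (r : rel T).

Lemma card_filter_sum A (P : pred T) :
  #|[set x in A | P x]| = \sum_(x in A) (P x : nat).
Proof.
rewrite -sum1_card big_mkcond [RHS]big_mkcond; apply: eq_bigr => x _.
by rewrite inE; case: (x \in A); case: (P x).
Qed.

Lemma double_count A B r :
  \sum_(x in A) #|[set y in B | r x y]| = \sum_(y in B) #|[set x in A | r x y]|.
Proof.
under eq_bigr do rewrite card_filter_sum.
by rewrite exchange_big; apply: eq_bigr => y _; rewrite card_filter_sum.
Qed.

Lemma leq_sum_const A (F : T -> nat) k :
  {in A, forall x, F x <= k} -> \sum_(x in A) F x <= #|A| * k.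
Proof. by move=> Fk; rewrite -sum_nat_const; apply: leq_sum. Qed.

Lemma geq_sum_const A (F : T -> nat) k :
  {in A, forall x, k <= F x} -> #|A| * k <= \sum_(x in A) F x.
Proof. by move=> Fk; rewrite -sum_nat_const; apply: leq_sum. Qed.

Lemma cover_count A N r k :
  {in N, forall z, exists2 x, x \in A & r x z} ->
  {in A, forall x, #|[set z in N | r x z]| <= k} -> #|N| <= #|A| * k.
Proof.
move=> cov bnd; apply: leq_trans (leq_sum_const bnd).
rewrite double_count -[#|N|]muln1; apply: geq_sum_const => z /cov[x xA rxz].
by rewrite card_gt0; apply/set0Pn; exists x; rewrite inE xA.
Qed.

Lemma sum_tight A (F F' : T -> nat) :
  {in A, forall x, F x <= F' x} -> \sum_(x in A) F' x <= \sum_(x in A) F x ->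
  {in A, forall x, F x = F' x}.
Proof.
move=> FF' le_sum x xA; apply/eqP; rewrite eqn_leq FF' //=.
move: le_sum; rewrite (bigD1 x xA) [leqRHS](bigD1 x xA) => le_sum.
rewrite -(leq_add2r (\sum_(i in A | i != x) F i)).
by apply: leq_trans le_sum; rewrite leq_add2l; apply: leq_sum => i /andP[/FF'].
Qed.

(** Below, B, M and N stand for the middle, maximal and minimal points of a
poset; nu x y and nd x z say that x is not below y and not above z. *)
Section Incidence.
Variables (B M N : {set T}) (nu nd : rel T).
Hypothesis nu_le : {in B, forall x, #|[set y in M | nu x y]| <= #|M| - 2}.
Hypothesis nd_le : {in B, forall x, #|[set z in N | nd x z]| <= #|N| - 2}.
Hypothesis miss : {in M & N, forall y z, exists2 x, x \in B & nu x y && nd x z}.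

(** For fixed y, the rows missing y must between them miss every z of N, but
each of them misses at most #|N| - 2. *)
Lemma miss_count : {in M, forall y,
  #|N| <= #|[set x in B | nu x y]| * (#|N| - 2)}.
Proof.
move=> y yM; apply: (@cover_count _ _ nd) => [z zN|x].
  by have [x xB /andP[? ?]] := miss yM zN; exists x; rewrite // inE xB.
by rewrite inE => /andP[/nd_le].
Qed.

Lemma total_count s : {in M, forall y, s <= #|[set x in B | nu x y]|} ->
  #|M| * s <= #|B| * (#|M| - 2).
Proof.
move=> sP; apply: leq_trans (geq_sum_const sP) _.
by rewrite -double_count; apply: leq_sum_const.
Qed.

(** Here both counts of the pairs (x, y) with nu x y are bounded by 8, one from
below and one from above, so all the estimates are equalities. *)
Lemma tight_count : #|B| = 4 -> #|M| = 4 -> #|N| = 4 ->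
  {in M, forall y, #|[set x in B | nu x y]| = 2} /\
  {in B, forall x, #|[set y in M | nu x y]| = 2}.
Proof.
move=> B4 M4 N4; have two : {in M, forall y, 2 <= #|[set x in B | nu x y]|}.
  by move=> y /miss_count; rewrite N4; lia.
have nu2 : {in B, forall x, #|[set y in M | nu x y]| <= 2}.
  by move=> x /nu_le; rewrite M4.
have eq8 : \sum_(x in B) 2 = \sum_(y in M) 2.
  by rewrite !sum_nat_const B4 M4.
split=> [y yM|].
  apply/esym/(sum_tight two _ yM).
  by rewrite -double_count -eq8; apply: leq_sum.
apply: sum_tight => //; rewrite eq8 double_count; exact: leq_sum.
Qed.

End Incidence.

(** The bound of [miss_count] forces at least 3 rows to miss each y if #|N| = 3,
and at least 2 if #|N| > 3; counting the pairs (x, y) with nu x y in both ways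
bounds #|B| from below, and only finitely many sizes remain. *)
Lemma incidence_bound B M N (nu nd : rel T) :
  {in B, forall x, #|[set y in M | nu x y]| <= #|M| - 2} ->
  {in B, forall x, #|[set z in N | nd x z]| <= #|N| - 2} ->
  {in M & N, forall y z, exists2 x, x \in B & nu x y && nd x z} ->
  0 < #|M| -> 0 < #|N| -> #|B| + #|M| + #|N| <= 12 ->
  [/\ #|B| = 4, #|M| = 4 & #|N| = 4].
Proof.
move=> nuP ndP miss M0 N0 le12.
have miss' : {in N & M, forall z y, exists2 x, x \in B & nd x z && nu x y}.
  by move=> z y zN yM; have [x] := miss y z yM zN; exists x; rewrite // andbC.
pose s k := if k == 3 then 3 else 2.
have sP k i : 0 < k -> k <= i * (k - 2) -> s k <= i.
  by rewrite /s; case: eqP => [->|k3]; [lia|case: i => [|[|i]]; lia].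
have hM : #|M| * s #|N| <= #|B| * (#|M| - 2).
  by apply: (total_count nuP) => y /(miss_count ndP miss); exact: sP.
have hN : #|N| * s #|M| <= #|B| * (#|N| - 2).
  by apply: (total_count ndP) => z /(miss_count nuP miss'); exact: sP.
move: hM hN; rewrite /s; move: #|B| #|M| #|N| M0 N0 le12 => b m n M0 N0 le12.
have : m <= 12 by lia.
have : n <= 12 by lia.
clear -M0 N0 le12; move=> hn hm.
(* all sizes but the last are excluded *)
do 13?[case: m M0 le12 hm => [|m] // M0 le12 hm];
  do 13?[case: n N0 le12 hn => [|n] // N0 le12 hn]; rewrite /=; try lia.
by move=> bM _; split=> //; lia.
Qed.

Lemma complement_pair (A : {set T}) (P : pred T) x y :
  #|A| = 4 -> #|[set z in A | P z]| = 2 -> x \in A -> y \in A -> x != y ->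
  ~~ P x -> ~~ P y -> forall z, z \in A -> P z = (z != x) && (z != y).
Proof.
move=> A4 P2 xA yA xy nPx nPy z zA.
have disj : [set x; y] \subset A :\: [set z in A | P z].
  by apply/subsetP => w /set2P[]->; rewrite !inE ?xA ?yA ?(negPf nPx) ?(negPf nPy).
have /eqP/setP/(_ z) : [set x; y] == A :\: [set z in A | P z].
  rewrite eqEcard disj cards2 xy cardsD (setIidPr _) ?A4 ?P2 //.
  by apply/subsetP => w; rewrite inE => /andP[].
by rewrite !inE zA /= andbT -negb_or => ->; rewrite negbK.
Qed.

(** Take the pair q, q' of rows missing some y, and let p, p' be the other two.
No z lies below both q and q', since (y, z) is missed by one of them.  The pairs
{p, p'} and {q, q'} answer unless p and p' have the same two upper bounds; then
neither q nor q' shares an upper bound with p, and exchanging p' with q or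
with q' gives the answer. *)
Lemma good_pairing B M N (nu nd : rel T) :
  #|B| = 4 -> #|M| = 4 -> #|N| = 4 ->
  {in M, forall y, #|[set x in B | nu x y]| = 2} ->
  {in B, forall x, #|[set y in M | nu x y]| = 2} ->
  {in B, forall x, #|[set z in N | nd x z]| = 2} ->
  {in M & N, forall y z, exists2 x, x \in B & nu x y && nd x z} ->
  exists p p' q q', [/\ p \in B, p' \in B, q \in B & q' \in B] /\
    [/\ p != p', q != q', B \subset [set p; p'; q; q'],
       exists y0, forall y, y \in M -> ~~ nu p y -> ~~ nu p' y -> y = y0 &
       exists z0, forall z, z \in N -> ~~ nd q z -> ~~ nd q' z -> z = z0].
Proof.
move=> B4 M4 N4 colM rowM rowN miss.
have dec (A : {set T}) (P : pred T) : A != set0 ->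
    (exists y0, forall y, y \in A -> P y -> y = y0) \/
    (exists y y', [/\ y \in A, y' \in A, y != y', P y & P y']).
  case/set0Pn=> a aA; have [|] := boolP [exists y in A, P y].
    case/exists_inP=> y yA Py.
    have [|] := boolP [exists y' in A, (y != y') && P y'].
      by case/exists_inP=> y' y'A /andP[yy' Py']; right; exists y, y'.
    rewrite negb_exists => /forallP un; left; exists y => y' y'A Py'.
    by have := un y'; rewrite y'A Py' andbT /= negbK => /eqP.
  by rewrite negb_exists => /forallP un; left; exists a => y yA Py; 
    have := un y; rewrite yA Py.
have [y yM] : exists y, y \in M by apply/set0Pn; rewrite -card_gt0 M4.
have /eqP/cards2P[q [q' [qq' eqQ]]] := colM y yM.
have inQ w : (w \in B) && nu w y = (w \in [set q; q']) by rewrite -eqQ inE.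
have [/andP[qB qy] /andP[q'B q'y]] :
  (q \in B) && nu q y /\ (q' \in B) && nu q' y by rewrite !inQ !inE !eqxx orbT.
have /cards2P[p [p' [pp' eqPP]]] : #|B :\: [set q; q']| == 2.
  rewrite cardsD (setIidPr _) ?B4 ?cards2 ?qq' //.
  by apply/subsetP => w; rewrite -inQ => /andP[].
have inP w : (w \in B) && ~~ nu w y = (w \in [set p; p']).
  rewrite -eqPP in_setD -inQ; by case: (w \in B); rewrite ?andbT ?andbF.
have [/andP[pB py] /andP[p'B p'y]] :
  (p \in B) && ~~ nu p y /\ (p' \in B) && ~~ nu p' y.
  by rewrite !inP !inE !eqxx orbT.
have BE : B \subset [set p; p'; q; q'].
  apply/subsetP => w wB; have := inP w; have := inQ w.
  rewrite !inE wB /=; case: (nu w y) => /=; last by move=> _ <-.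
  by move=> /esym/orP[]->; rewrite ?orbT.
have noQ z : z \in N -> nd q z || nd q' z.
  move=> zN; have [w wB /andP[wy wz]] := miss y z yM zN.
  have : w \in [set q; q'] by rewrite -inQ wB.
  by case/set2P=> <-; rewrite wz ?orbT.
have [z0 z0N] : exists z, z \in N by apply/set0Pn; rewrite -card_gt0 N4.
(* either p and p' share at most one upper bound, or they share two *)
have [[y0 y0P]|[y1 [y2 [y1M y2M y12 /andP[py1 p'y1] /andP[py2 p'y2]]]]] :=
  dec M (fun y => ~~ nu p y && ~~ nu p' y) ltac:(by rewrite -card_gt0 M4).
  exists p, p', q, q'; do 2!split=> //.
    by exists y0 => u uM up up'; apply: y0P; rewrite ?up.
  by exists z0 => z /noQ/orP[]->.
have pE := complement_pair M4 (rowM p pB) y1M y2M y12 py1 py2.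
have p'E := complement_pair M4 (rowM p' p'B) y1M y2M y12 p'y1 p'y2.
have qlow w : w \in B -> w != p -> w != p' -> nu w y1 && nu w y2.
  move=> wB wp wp'.
  rewrite (complement_pair B4 (colM y1 y1M) pB p'B pp' py1 p'y1 wB) wp wp'.
  by rewrite (complement_pair B4 (colM y2 y2M) pB p'B pp' py2 p'y2 wB) wp wp'.
have qp : q != p by apply: contraNneq py => <-.
have qp' : q != p' by apply: contraNneq p'y => <-.
have q'p : q' != p by apply: contraNneq py => <-.
have q'p' : q' != p' by apply: contraNneq p'y => <-.
have /andP[qy1 qy2] := qlow q qB qp qp'.
have /andP[q'y1 q'y2] := qlow q' q'B q'p q'p'.
have none w : nu w y1 -> nu w y2 -> forall u, u \in M -> ~~ nu p u -> ~~ nu w u -> u = y1.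
  move=> w1 w2 u uM; rewrite pE // negb_and !negbK => /orP[]/eqP-> //.
  by rewrite w2.
(* the pairs {p, q} and {p', q'} answer if p' and q' share at most one lower
   bound; if they share two, q and p' share none *)
have [[z1 z1P]|[z1 [z2 [z1N z2N z12 /andP[a1 b1] /andP[a2 b2]]]]] :=
  dec N (fun z => ~~ nd p' z && ~~ nd q' z) ltac:(by rewrite -card_gt0 N4).
  exists p, q, p', q'; do 2!split; rewrite // ?[p == q]eq_sym ?[p' == q']eq_sym //.
  - apply: subset_trans BE _; apply/subsetP=> w; rewrite !inE.
    by case: (w == p); case: (w == p'); case: (w == q).
  - by exists y1; apply: none.
  - by exists z1 => z zN zp zq; apply: z1P; rewrite ?zp.
exists p, q', p', q; do 2!split; rewrite // ?[p == q']eq_sym ?[p' == q]eq_sym //.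
- apply: subset_trans BE _; apply/subsetP=> w; rewrite !inE.
  by case: (w == p); case: (w == p'); case: (w == q); case: (w == q').
- by exists y1; apply: none.
- have E' := complement_pair N4 (rowN p' p'B) z1N z2N z12 a1 a2.
  have E2 := complement_pair N4 (rowN q' q'B) z1N z2N z12 b1 b2.
  exists z1 => z zN; rewrite E' // -E2 // => nq' nq.
  by have := noQ z zN; rewrite (negPf nq) (negPf nq').
Qed.

End Counting.

(** * Flat sets of a cocycle on a poset *)

Local Open Scope group_scope.

(** A functor from the poset to the group G, as the values g x y on the pairs
x <= y. *)
Record cocycle (T : finType) (G : groupType) (le : rel T) (g : T -> T -> G) :
    Prop := Cocycle {
  le_refl : reflexive le;
  le_anti : antisymmetric le;
  le_trans : transitive le;
  cocycleM : forall x y z, le x y -> le y z -> g x y * g y z = g x z }.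

Definition dual_rel (T : Type) (le : rel T) : rel T := fun x y => le y x.
Definition dual_cocycle (T : Type) (G : groupType) (g : T -> T -> G) :=
  fun x y => (g y x)^-1.

Lemma cocycle_dual (T : finType) (G : groupType) (le : rel T) (g : T -> T -> G) :
  cocycle le g -> cocycle (dual_rel le) (dual_cocycle g).
Proof.
case=> lexx anti trans gM; split=> //.
- by move=> x y /andP[? ?]; apply: anti; apply/andP.
- by move=> y x z /= yx zy; apply: trans zy yx.
- by move=> x y z yx zy; rewrite /dual_cocycle -invgM gM.
Qed.

Section Flat.
Variables (T : finType) (G : groupType) (le : rel T) (g : T -> T -> G).
Hypothesis leg : cocycle le g.
Implicit Types (A B S : {set T}) (x y z w : T).

Let lexx := le_refl leg.
Let ltrans := @le_trans _ _ _ _ leg.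
Let gM := cocycleM leg.

Lemma cocycle1 x : g x x = 1.
Proof. by apply: (mulgI (g x x)); rewrite gM // mulg1. Qed.

(** On a connected part, f exists exactly when the holonomy of g along every
closed chain of comparisons in A is trivial. *)
Definition flat A :=
  exists f : T -> G, {in A &, forall x y, le x y -> f x * g x y = f y}.

Lemma flatS A B : A \subset B -> flat B -> flat A.
Proof.
by move=> /subsetP AB [f fB]; exists f => x y xA yA; apply: fB; apply: AB.
Qed.

Definition splits S := exists A B, [/\ S \subset A :|: B, flat A & flat B].

Definition maxima S := [set x in S | [forall y in S, le x y ==> (y == x)]].

Lemma maximaP S x :
  reflect (x \in S /\ forall y, y \in S -> le x y -> y = x) (x \in maxima S).
Proof.
rewrite inE; apply: (iffP andP) => -[xS h]; split=> //.
  by move=> y yS xy; move/forall_inP/(_ y yS): h; rewrite xy => /eqP.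
by apply/forall_inP=> y yS; apply/implyP => /(h y yS)->.
Qed.

Lemma maxima_sub S : maxima S \subset S.
Proof. by apply/subsetP => x /maximaP[]. Qed.

Lemma maxima_above S x : x \in S -> exists2 y, y \in maxima S & le x y.
Proof.
move=> xS; pose up y := [set w in S | le y w].
have xP : (x \in S) && le x x by rewrite xS lexx.
case: (@arg_minnP _ x (fun y => (y \in S) && le x y) (fun y => #|up y|) xP) => y /andP[yS xy] ymin.
exists y => //; apply/maximaP; split=> // z zS yz.
have sub : up z \subset up y.
  by apply/subsetP => w; rewrite !inE => /andP[-> /(ltrans yz)].
have : up z == up y by rewrite eqEcard sub ymin // zS (ltrans xy yz).
move/eqP/setP/(_ y); rewrite !inE yS lexx /= => zy.
by apply: (le_anti leg); rewrite yz zy.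
Qed.

(** The gauge is (g v y)^-1 on the points below the apex y; a minimal point that
is not below y is comparable to no other point of the set. *)
Lemma flat_cone A N y :
  {in A, forall v, le v y} -> {in A :|: N & N, forall v w, le v w -> v = w} ->
  flat (A :|: N).
Proof.
move=> below minN.
exists (fun v => if le v y then (g v y)^-1 else 1) => v w vAN wAN vw.
have [wy|wy] := boolP (le w y).
  by rewrite (ltrans vw wy) -(gM vw wy) invgM mulgVK.
have wN : w \in N.
  by move: wAN; rewrite inE => /orP[/below|//]; rewrite (negPf wy).
by rewrite (minN _ _ vAN wN vw) (negPf wy) cocycle1 mulg1.
Qed.

(** Two gauges can be made to agree at the single common point y0 by a left
translation of one of them. *)
Lemma flat_glue A B y0 : flat A -> flat B ->
  {in A & B, forall v w, v = w -> v = y0} ->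
  {in A & B, forall v w, le v w || le w v -> (v \in B) || (w \in A)} ->
  flat (A :|: B).
Proof.
move=> [fA fAP] [fB fBP] AB1 cross.
pose f v := if v \in A then fA v else fA y0 * (fB y0)^-1 * fB v.
have fE v : v \in B -> f v = fA y0 * (fB y0)^-1 * fB v.
  by rewrite /f; case: ifP => // vA vB; rewrite (AB1 v v) // mulgVK.
have fAE v : v \in A -> f v = fA v by rewrite /f => ->.
have sameB v w : v \in B -> w \in B -> le v w -> f v * g v w = f w.
  by move=> vB wB vw; rewrite !fE // -mulgA fBP.
have sameA v w : v \in A -> w \in A -> le v w -> f v * g v w = f w.
  by move=> vA wA vw; rewrite !fAE // fAP.
exists f => v w /setUP[vA|vB] /setUP[wA|wB] vw; [exact: sameA| | |exact: sameB].
  by have /orP[|] := cross v w vA wB ltac:(by rewrite vw);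
    [move/sameB; apply|move/(sameA _ _ vA); apply].
by have /orP[|] := cross w v wA vB ltac:(by rewrite vw orbT);
  [move/(sameB _ _ vB); apply|move/sameA; apply].
Qed.

(** Every comparison with x factors through y, so x can be given the gauge
f y * (g x y)^-1. *)
Lemma flat_dominated A x y : flat A -> y \in A -> le x y ->
  {in A, forall w, le x w -> le w y || le y w} -> flat (x |: A).
Proof.
move=> [f fP] yA xy dom; have [xA|xA] := boolP (x \in A).
  by exists f; rewrite (setUidPr _) // sub1set.
pose f' v := if v == x then f y * (g x y)^-1 else f v.
have f'E v : v \in A -> f' v = f v.
  by rewrite /f'; case: eqP => // -> xA'; rewrite xA' in xA.
have f'x : f' x = f y * (g x y)^-1 by rewrite /f' eqxx.
exists f' => v w /setU1P[->|vA] /setU1P[->|wA] vw.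
- by rewrite cocycle1 mulg1.
- rewrite f'x f'E //; have /orP[wy|yw] := dom w wA vw.
    by rewrite -(fP w y) // -(gM vw wy) invgM !mulgA mulgK mulgVK.
  by rewrite -(gM xy yw) mulgA mulgVK fP.
- by rewrite f'x f'E // -(fP v y) ?(ltrans vw xy) // -(gM vw xy) !mulgA mulgK.
- by rewrite !f'E // fP.
Qed.

Lemma splits_setU1 S A B x :
  S :\ x \subset A :|: B -> flat (x |: (A :&: S)) -> flat B -> splits S.
Proof.
move=> SAB flA flB; exists (x |: (A :&: S)), B; split=> //.
  apply/subsetP=> w wS; have [-> | wx] := eqVneq w x; first by rewrite !inE eqxx.
  have : w \in A :|: B by apply: (subsetP SAB); rewrite !inE wx.
  by rewrite !inE wS andbT (negPf wx).
Qed.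

Lemma splits_dominated S x y : x \in S -> y \in S -> x != y -> le x y ->
  {in S, forall w, le x w -> le w y || le y w} -> splits (S :\ x) -> splits S.
Proof.
move=> xS yS xy lexy dom [A [B [SAB flA flB]]].
wlog yA : A B SAB flA flB / y \in A.
  move=> thm; have : y \in A :|: B by apply: (subsetP SAB); rewrite !inE eq_sym xy.
  case/setUP=> [yA|yB]; first exact: thm flA flB yA.
  by apply: thm flB flA yB; rewrite setUC.
apply: splits_setU1 SAB _ flB.
apply: (flat_dominated (y := y)) => //; last by move=> w /setIP[_ /dom].
- exact: flatS (subsetIl _ _) flA.
- by rewrite inE yA.
Qed.

(** If y is the only maximal point above x, then everything above x is
below y. *)
Lemma splits_unique_above S x y : x \in S -> x \notin maxima S ->
  (forall w, w \in maxima S -> le x w -> w = y) -> splits (S :\ x) -> splits S.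
Proof.
move=> xS xM uniq; have [y' y'M xy'] := maxima_above xS.
have eqy := uniq y' y'M xy'; rewrite {y'}eqy in y'M xy'.
apply: (splits_dominated (y := y)) => //.
- exact: (subsetP (maxima_sub S)).
- by apply: contraNneq xM => ->.
- move=> w wS xw; have [y' y'M' wy'] := maxima_above wS.
  by rewrite -(uniq y' y'M' (ltrans xw wy')) wy'.
Qed.

Lemma splits_isolated S x : x \in S ->
  {in S, forall w, le x w || le w x -> w = x} -> splits (S :\ x) -> splits S.
Proof.
move=> xS iso [A [B [SAB flA flB]]].
apply: splits_setU1 SAB _ flB; apply: (@flat_glue _ _ x).
- by exists (fun=> 1) => v w /set1P-> /set1P->; rewrite cocycle1 mul1g.
- exact: flatS (subsetIl _ _) flA.
- by move=> v w /set1P->.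
- by move=> v w /set1P-> /setIP[_ /iso wS] /wS->; rewrite set11 orbT.
Qed.

End Flat.

Section Dual.
Variables (T : finType) (G : groupType) (le : rel T) (g : T -> T -> G).
Hypothesis leg : cocycle le g.
Implicit Types (A B S N : {set T}) (x y z w : T).

Lemma flat_dual A : flat (dual_rel le) (dual_cocycle g) A <-> flat le g A.
Proof.
split=> -[f fP]; exists f => v w vA wA vw.
  by rewrite -(fP w v wA vA vw) mulgVK.
by rewrite -(fP w v wA vA vw) mulgK.
Qed.

Lemma splits_dual S : splits (dual_rel le) (dual_cocycle g) S <-> splits le g S.
Proof.
by split=> -[A [B [SAB /flat_dual flA /flat_dual flB]]]; exists A, B.
Qed.

Lemma flat_cocone A N y :
  {in A, forall v, le y v} -> {in A :|: N & N, forall v w, le w v -> v = w} ->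
  flat le g (A :|: N).
Proof.
by move=> above maxN; apply/flat_dual/(flat_cone (cocycle_dual leg) above maxN).
Qed.

(** The first flat set consists of p and the maximal points above it, the second
of p', the maximal points above p' and those not above p; they meet at most
in y0. *)
Lemma flat_two_stars S p p' y0 : p \in S -> p' \in S ->
  p \notin maxima le S -> p' \notin maxima le S -> ~~ le p p' -> ~~ le p' p ->
  (forall y, y \in maxima le S -> le p y -> le p' y -> y = y0) ->
  flat le g ([set p; p'] :|: maxima le S).
Proof.
move=> pS p'S pM p'M npp' np'p share.
pose A := p |: [set y in maxima le S | le p y].
pose N := [set y in maxima le S | ~~ le p y].
pose B := (p' |: [set y in maxima le S | le p' y]) :|: N.
have lexx := le_refl leg.
have maxE y w : y \in maxima le S -> w \in S -> le y w -> w = y.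
  by case/maximaP=> _ h; exact: h.
have MS y : y \in maxima le S -> y \in S by apply/subsetP/maxima_sub.
have inA y : y \in A = (y == p) || (y \in maxima le S) && le p y.
  by rewrite !inE.
have inB y : y \in B =
    (y == p') || (y \in maxima le S) && (le p' y || ~~ le p y).
  by rewrite in_setU in_setU1 [y \in N]inE [_ \in finset _]inE -orbA -andb_orr.
have flA : flat le g A.
  rewrite -[A]setU0; apply: (flat_cocone (y := p)); last by move=> v w _; rewrite inE.
  by move=> v; rewrite inA => /orP[/eqP->|/andP[]] //.
have flB : flat le g B.
  apply: (flat_cocone (y := p')).
    by move=> v /setU1P[->|] //; rewrite inE => /andP[].
  move=> v w vB; rewrite inE => /andP[wM _]; apply: maxE => //.
  by move: vB; rewrite inB => /orP[/eqP->|/andP[/MS]].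
have sub : [set p; p'] :|: maxima le S \subset A :|: B.
  apply/subsetP=> y; rewrite in_setU in_set2 in_setU inA inB.
  case: (y == p) => //; case: (y == p'); rewrite ?orbT //.
  by case: (y \in _) => //; case: (le p y); rewrite ?orbT.
apply: flatS sub _; apply: (flat_glue (y0 := y0)) => // v w.
  rewrite inA inB => vA + vw; rewrite -{}vw; move: vA.
  case/orP=> [/eqP->|/andP[vM pv]].
    by rewrite (negPf pM) orbF => /eqP pp'; rewrite -pp' lexx in npp'.
  case/orP=> [/eqP vp'|/andP[_]]; first by rewrite vp' (negPf npp') in pv.
  by rewrite pv orbF; exact: share.
rewrite !inA !inB => /orP[/eqP->|/andP[vM pv]] /orP[/eqP->|/andP[wM p'w]].
- by rewrite (negPf npp') (negPf np'p).
- case/orP=> [pw|/(maxE _ _ wM pS) pw]; first by rewrite wM pw !orbT.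
  by rewrite pw eqxx orbT.
- case/orP=> [/(maxE _ _ vM p'S) p'v|p'v]; last by rewrite vM p'v orbT.
  by rewrite p'v eqxx.
- case/orP=> [/(maxE _ _ vM (MS _ wM))->|/(maxE _ _ wM (MS _ vM))<-].
    by rewrite vM pv !orbT.
  by rewrite vM pv !orbT.
Qed.

End Dual.

(** * Posets with at most 12 points *)

Section Small.
Variables (T : finType) (G : groupType).
Implicit Types (le : rel T) (g : T -> T -> G) (A B S : {set T}) (x y z : T).

Definition minima le S := maxima (dual_rel le) S.
Definition middle le S := S :\: (maxima le S :|: minima le S).

Lemma middleP le S x :
  (x \in middle le S) = [&& x \in S, x \notin maxima le S & x \notin minima le S].
Proof. by rewrite !in_setD in_setU negb_or andbC. Qed.

Lemma splits_few_above le g S x : cocycle le g -> x \in middle le S ->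
  #|[set y in maxima le S | le x y]| <= 1 ->
  splits le g (S :\ x) -> splits le g S.
Proof.
move=> leg; rewrite middleP => /and3P[xS xM _] few.
have [y yM xy] := maxima_above leg xS.
apply: (splits_unique_above leg (y := y)) => // w wM xw.
by move/card_le1_eqP: few; apply; rewrite inE ?wM ?yM.
Qed.

Lemma splits_few_below le g S x : cocycle le g -> x \in middle le S ->
  #|[set z in minima le S | le z x]| <= 1 ->
  splits le g (S :\ x) -> splits le g S.
Proof.
move=> leg xB few sp; apply/splits_dual.
apply: (splits_few_above (cocycle_dual leg) (x := x)) => //.
  by rewrite /middle setUC.
exact/splits_dual.
Qed.

Lemma splits_two_cones le g S y z : cocycle le g ->
  y \in maxima le S -> z \in minima le S ->
  {in middle le S, forall x, le x y || le z x} -> splits le g S.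
Proof.
move=> leg yM zN cov.
have subS : {subset maxima le S <= S} /\ {subset minima le S <= S}.
  by split; apply/subsetP/maxima_sub.
exists ([set x in S | le x y] :|: minima le S),
       ([set x in S | le z x] :|: maxima le S); split.
- apply/subsetP => x xS; have := cov x; rewrite middleP !inE xS /=.
  by do 2!case: [forall (_ | _), _]; rewrite ?orbT ?orbF //= => ->.
- apply: (flat_cone leg (y := y)) => [v|v w]; first by rewrite inE => /andP[].
  move=> vS /maximaP[_ h]; apply: h.
  by case/setUP: vS => [|/subS.2 //]; rewrite inE => /andP[].
- apply: (flat_cocone leg (y := z)) => [v|v w]; first by rewrite inE => /andP[].
  move=> vS /maximaP[_ h]; apply: h.
  by case/setUP: vS => [|/subS.1 //]; rewrite inE => /andP[].
Qed.

(** By the count each middle point misses exactly two maximal points, so all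
middle points above x have the same maximal points above them as x; and x and
x' are the only middle points below such a maximal point y.  Hence everything
above x is comparable to x'. *)
Lemma splits_comparable le g S x x' : cocycle le g ->
  x \in middle le S -> x' \in middle le S -> x != x' -> le x x' ->
  #|maxima le S| = 4 ->
  #|middle le S| = 4 ->
  {in maxima le S, forall y, #|[set x in middle le S | ~~ le x y]| = 2} ->
  {in middle le S, forall x, #|[set y in maxima le S | ~~ le x y]| = 2} ->
  splits le g (S :\ x) -> splits le g S.
Proof.
move=> leg xB x'B xx' lexx' M4 B4 col row.
have trans := @le_trans _ _ _ _ leg.
have up w y : w \in middle le S -> y \in maxima le S -> le x w -> le x y -> le w y.
  move=> wB yM xw xy; apply: contraLR xy => nwy.
  have /eqP/setP/(_ y) : [set y in maxima le S | ~~ le x y] ==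
      [set y in maxima le S | ~~ le w y].
    rewrite eqEcard !row // andbT; apply/subsetP=> u; rewrite !inE.
    by case/andP=> -> /=; apply: contra; apply: trans.
  by rewrite [LHS]inE [RHS]inE yM nwy.
move: (xB) (x'B); rewrite !middleP => /and3P[xS xM xN] /and3P[x'S _ _].
apply: (splits_dominated leg (y := x')) => // w wS xw.
have [wM|wM] := boolP (w \in maxima le S); first by rewrite (up x' w) ?orbT.
have [wN|wN] := boolP (w \in minima le S).
  by case/maximaP: (wN) xN => _ /(_ x xS xw) -> /negP.
have wB : w \in middle le S by rewrite middleP wS wM.
have [->|wx] := eqVneq w x; first by rewrite lexx'.
have [->|wx'] := eqVneq w x'; first by rewrite (le_refl leg).
have [y yM xy] := maxima_above leg xS.
have := complement_pair B4 (col y yM) xB x'B xx'.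
rewrite xy (up x' y) // => /(_ isT isT w wB).
by rewrite wx wx' (up w y).
Qed.

Theorem small_splits le g S : cocycle le g -> #|S| <= 12 -> splits le g S.
Proof.
move=> leg; have [n] := ubnP #|S|; elim: n S => // n IH S Sn S12.
have rec x : x \in S -> splits le g (S :\ x).
  move=> xS; have := cardsD1 x S; rewrite xS => eqS.
  by apply: IH; lia.
set M := maxima le S; set N := minima le S; set B := middle le S.
have MS : M \subset S := maxima_sub _ _.
have NS : N \subset S := maxima_sub _ _.
have BS : {subset B <= S} by move=> x; rewrite middleP => /andP[].
have [->|[x0 x0S]] := set_0Vmem S.
  by exists set0, set0; split; [exact: sub0set| |];
    exists (fun=> 1%g) => x y; rewrite inE.
have [y0 y0M _] := maxima_above leg x0S.
have [z0 z0N _] := maxima_above (cocycle_dual leg) x0S.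
have [MN0|[x /setIP[/maximaP[xS xM] /maximaP[_ xN]]]] := set_0Vmem (M :&: N); last first.
  apply: (splits_isolated leg xS _ (rec x xS)) => w wS.
  by case/orP; [exact: xM | exact: xN].
have card3 : #|B| + #|M| + #|N| <= 12.
  rewrite -addnA -cardsUI MN0 cards0 addn0 cardsDS ?subUset ?MS //.
  by rewrite subnK // subset_leq_card // subUset MS.
have [/exists_inP[x xB few]|] :=
    boolP [exists x in B, #|[set y in M | le x y]| <= 1].
  exact: (splits_few_above leg xB few (rec x (BS x xB))).
rewrite negb_exists => /forallP up2.
have [/exists_inP[x xB few]|] :=
    boolP [exists x in B, #|[set z in N | le z x]| <= 1].
  exact: (splits_few_below leg xB few (rec x (BS x xB))).
rewrite negb_exists => /forallP down2.
have [/exists_inP[y yM /exists_inP[z zN /forall_inP cov]]|] :=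
    boolP [exists y in M, exists z in N, forall x in B, le x y || le z x].
  exact: splits_two_cones cov.
rewrite negb_exists => /forallP cov.
pose nu x y := ~~ le x y; pose nd x z := ~~ le z x.
have few_left (P : pred T) A : 1 < #|[set y in A | P y]| ->
    #|[set y in A | ~~ P y]| <= #|A| - 2.
  have -> : [set y in A | ~~ P y] = A :\: [set y in A | P y].
    by apply/setP=> y; rewrite !inE; case: (y \in A); rewrite ?andbF ?andbT.
  by rewrite cardsDS ?subsetIl; [lia|apply/subsetP=> y; rewrite inE => /andP[]].
have nuP : {in B, forall x, #|[set y in M | nu x y]| <= #|M| - 2}.
  by move=> x xB; apply: few_left; have := up2 x; rewrite xB /= -ltnNge.
have ndP : {in B, forall x, #|[set z in N | nd x z]| <= #|N| - 2}.
  by move=> x xB; apply: few_left; have := down2 x; rewrite xB /= -ltnNge.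
have miss : {in M & N, forall y z, exists2 x, x \in B & nu x y && nd x z}.
  move=> y z yM zN; have := cov y; rewrite yM negb_exists => /forallP/(_ z).
  rewrite zN negb_forall => /existsP[x]; rewrite negb_imply negb_or => /andP[].
  by exists x.
have [] := incidence_bound nuP ndP miss _ _ card3.
- by rewrite card_gt0; apply/set0Pn; exists y0.
- by rewrite card_gt0; apply/set0Pn; exists z0.
move=> B4 M4 N4; have [colM rowM] := tight_count nuP ndP miss B4 M4 N4.
have miss' : {in N & M, forall z y, exists2 x, x \in B & nd x z && nu x y}.
  by move=> z y zN yM; have [x] := miss y z yM zN; exists x; rewrite // andbC.
have [colN rowN] := tight_count ndP nuP miss' B4 N4 M4.
have [/exists_inP[x xB /exists_inP[x' x'B /andP[xx' lexx']]]|] :=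
    boolP [exists x in B, exists x' in B, (x != x') && le x x'].
  exact: (splits_comparable leg xB x'B xx' lexx' M4 B4 colM rowM (rec x (BS x xB))).
rewrite negb_exists => /forallP anti.
have antiB x x' : x \in B -> x' \in B -> x != x' -> ~~ le x x'.
  move=> xB x'B xx'; have := anti x; rewrite xB negb_exists => /forallP/(_ x').
  by rewrite x'B xx'.
have [p [p' [q [q' [[pB p'B qB q'B] [pp' qq' BE [y1 shareM] [z1 shareN]]]]]]] :=
  good_pairing B4 M4 N4 colM rowM rowN miss.
have notM x : x \in B -> x \notin M by rewrite middleP => /and3P[].
have notN x : x \in B -> x \notin N by rewrite middleP => /and3P[].
exists ([set p; p'] :|: M), ([set q; q'] :|: N); split.
- apply/subsetP=> x xS; have [xB|] := boolP (x \in B).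
    by have := subsetP BE x xB; rewrite !inE => /orP[/orP[->//|->]|->]; rewrite ?orbT.
  rewrite middleP xS /= negb_and !negbK !(in_setU x).
  by case/orP=> ->; rewrite ?orbT.
- apply: (flat_two_stars leg (y0 := y1)); rewrite ?notM ?BS ?antiB //.
    by rewrite eq_sym.
  by move=> y yM py p'y; apply: shareM; rewrite ?negbK.
- apply/flat_dual; apply: (flat_two_stars (cocycle_dual leg) (y0 := z1)).
  + exact: BS.
  + exact: BS.
  + exact: notN.
  + exact: notN.
  + by apply: antiB; rewrite // eq_sym.
  + exact: antiB.
  + by move=> z zN qz q'z; apply: shareN; rewrite ?negbK.
Qed.

End Small.

Import classical_sets.
Local Open Scope classical_set_scope.
Local Open Scope ring_scope.

Local Ltac cts := repeat first
  [ exact: ival_continuous | exact: ival1_cts | exact: ival2_cts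
  | exact: fst_cts | exact: snd_cts | exact: const_cts
  | apply: clamp_cts | apply: add_cts | apply: opp_cts | apply: mul_cts
  | apply: min_cts | apply: max_cts | apply: pair_cts ].

(** * Holonomy of paths *)

Section Groupoid.
Context {R : realType} {X : topologicalType}.
Local Notation I := (unit_interval R).
Implicit Types x y z : X.

(** The straight-line homotopy between the parametrizations phi and psi of one
path h, whose own endpoints need not be x and y. *)
Lemma homotopic_reparam x y (h : R -> X) (f g : {path I from x to y in X})
    (phi psi : I -> R) : continuous h -> continuous phi -> continuous psi ->
    phi zero = psi zero -> phi one = psi one ->
    (forall s, f s = h (phi s)) -> (forall s, g s = h (psi s)) ->
  path_homotopic f g.
Proof.
move=> ch cphi cpsi e0 e1 fE gE.
exists (fun w => h ((1 - ival w.2) * phi w.1 + ival w.2 * psi w.1)).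
split=> [|s|s|t] /=.
- apply: (comp_cts (k := h)) => //.
  by cts; [apply: (comp_cts (k := phi))|apply: (comp_cts (k := psi))] => //;
    exact: fst_cts.
- by rewrite ival0 subr0 mul1r mul0r addr0 fE.
- by rewrite ival1 subrr mul1r mul0r add0r gE.
- rewrite e0 e1 -!mulrDl subrK !mul1r -e0 -e1 -!fE.
  by rewrite path_zero path_one.
Qed.

Lemma clamp_path_cts x y (p : {path I from x to y in X}) :
  continuous (fun r => p (clamp r)).
Proof. by apply: (comp_cts (k := p)); [exact: cts_fun|exact: clamp_continuous]. Qed.

Lemma cat_pathV x y (p : {path I from x to y in X}) :
  path_homotopic (path_cat p (path_rev p)) (cst x : {path I from x to x in X}).
Proof.
apply: (@homotopic_reparam _ _ (fun r => p (clamp r)) _ _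
  (fun s => Num.min (2 * ival s) (2 - 2 * ival s)) (fun=> 0)).
- exact: clamp_path_cts.
- by cts.
- by cts.
- by rewrite ival0 minEle ifT; lra.
- by rewrite ival1 minEle ifF; [lra|apply/negP; lra].
- move=> s; have /andP[s0 s1] := ival_bounds s; rewrite /= path_catE /= /path_rev.
  case: (leP (ival s) 2^-1) => h2; first by rewrite minEle ifT //; lra.
  rewrite minEle ifF; last by apply/negP; lra.
  rewrite clampK; last by apply/andP; split; lra.
  by congr (p (clamp _)); lra.
- by move=> s; rewrite -[clamp 0]/zero path_zero.
Qed.

Lemma cat_Vpath x y (p : {path I from x to y in X}) :
  path_homotopic (path_cat (path_rev p) p) (cst y : {path I from y to y in X}).
Proof.
apply: (@homotopic_reparam _ _ (fun r => p (clamp r)) _ _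
  (fun s => Num.max (1 - 2 * ival s) (2 * ival s - 1)) (fun=> 1)).
- exact: clamp_path_cts.
- by cts.
- by cts.
- by rewrite ival0 maxEle ifF; [lra|apply/negP; lra].
- by rewrite ival1 maxEle ifT; lra.
- move=> s; have /andP[s0 s1] := ival_bounds s; rewrite /= path_catE /= /path_rev.
  case: (leP (ival s) 2^-1) => h2; last by rewrite maxEle ifT //; lra.
  rewrite (max_idPl _); last by lra.
  by rewrite clampK //; apply/andP; split; lra.
- by move=> s; rewrite -[clamp 1]/one path_one.
Qed.

Lemma cat_congl x y z (p p' : {path I from x to y in X})
    (q : {path I from y to z in X}) :
  path_homotopic p p' -> path_homotopic (path_cat p q) (path_cat p' q).
Proof. by move/path_homotopic_cat; apply; exact: path_homotopic_refl. Qed.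

Lemma cat_congr x y z (p : {path I from x to y in X})
    (q q' : {path I from y to z in X}) :
  path_homotopic q q' -> path_homotopic (path_cat p q) (path_cat p q').
Proof. by apply: path_homotopic_cat; exact: path_homotopic_refl. Qed.

Section Holonomy.
Variables (x0 : X) (gam : forall x, {path I from x0 to x in X}).

Definition hol x y (p : {path I from x to y in X}) : pi1 R x0 :=
  loop_class (path_cat (path_cat (gam x) p) (path_rev (gam y))).

Lemma hol_homotopic x y (p q : {path I from x to y in X}) :
  path_homotopic p q -> hol p = hol q.
Proof. by move=> pq; apply/loop_classP/cat_congl/cat_congr. Qed.

Lemma hol_eq x y x' y' (p : {path I from x to y in X})
    (q : {path I from x' to y' in X}) :
  x = x' -> y = y' -> p =1 q -> hol p = hol q.
Proof. by move=> ex ey; subst x' y' => /path_eqP->. Qed.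

Lemma hol_cat x y z (p : {path I from x to y in X}) (q : {path I from y to z in X}) :
  hol (path_cat p q) = (hol p * hol q)%g.
Proof.
rewrite [RHS]pi1_mul_class; apply/loop_classP; apply: path_homotopic_sym.
apply: path_homotopic_trans (path_homotopic_sym (path_catA _ _ _)) _.
apply: (@path_homotopic_trans _ _ _ _ _ (path_cat (path_cat (gam x) p)
                                           (path_cat q (path_rev (gam z))))).
  apply: cat_congr.
  apply: path_homotopic_trans (cat_congr _ (path_homotopic_sym (path_catA _ _ _))) _.
  apply: path_homotopic_trans (path_catA _ _ _) _.
  by apply: path_homotopic_trans _ (path_cat1p _); apply: cat_congl; exact: cat_Vpath.
apply: path_homotopic_trans (path_catA _ _ _) _.
by apply: cat_congl; apply: path_homotopic_sym; exact: path_catA.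
Qed.

Lemma hol_cst x : hol (cst x : {path I from x to x in X}) = 1%g.
Proof.
apply/loop_classP.
by apply: path_homotopic_trans _ (cat_pathV (gam x)); apply: cat_congl; exact: path_catp1.
Qed.

Lemma hol_inj x (p : {path I from x to x in X}) :
  hol p = 1%g -> path_homotopic p (cst x : {path I from x to x in X}).
Proof.
move/loop_classP => h.
have gp : path_homotopic (path_cat (gam x) p) (gam x).
  apply: path_homotopic_trans (path_homotopic_sym (path_catp1 _)) _.
  apply: path_homotopic_trans (cat_congr _ (path_homotopic_sym (cat_Vpath (gam x)))) _.
  apply: path_homotopic_trans (path_catA _ _ _) _.
  by apply: path_homotopic_trans (cat_congl _ h) _; exact: path_cat1p.
apply: path_homotopic_trans (path_homotopic_sym (path_cat1p _)) _.
apply: path_homotopic_trans (cat_congl _ (path_homotopic_sym (cat_Vpath (gam x)))) _.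
apply: path_homotopic_trans (path_homotopic_sym (path_catA _ _ _)) _.
by apply: path_homotopic_trans (cat_congr _ gp) _; exact: cat_Vpath.
Qed.

End Holonomy.
End Groupoid.

(** * Contractibility of minimal neighbourhoods *)

Section Cone.
Context {R : realType} {X : topologicalType}.
Local Notation I := (unit_interval R).
Implicit Types x y z : X.

Definition below x y := forall U : set X, open U -> U y -> U x.

Lemma below_refl x : below x x. Proof. by []. Qed.

Lemma below_trans x y z : below x y -> below y z -> below x z.
Proof. by move=> xy yz U oU Uz; apply: xy (yz _ oU Uz). Qed.

(** Every open set containing z contains the whole image of h, so continuity
is a condition only away from the fibre of z. *)
Lemma below_continuous (W : topologicalType) (h : W -> X) z :
  (forall w, below (h w) z) ->
  (forall w, h w <> z -> exists k : W -> X,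
     continuous k /\ \forall v \near w, h v = k v) ->
  continuous h.
Proof.
move=> hz loc w; have [hwz|/loc[k [ck hk]]] := pselect (h w = z).
  move=> V; rewrite hwz nbhsE /= => -[U [oU Uz] UV].
  by change (nbhs w (h @^-1` V)); apply: filterE => v; apply: UV; exact: hz.
move=> V; rewrite (nbhs_singleton hk) => /(ck w) Vk.
change (nbhs w (h @^-1` V)).
by apply: filterS2 hk Vk => v /= ->.
Qed.

(** The path which stays at x, visits z at time 1/2 and stays at y afterwards;
x and y being below z makes it continuous. *)
Definition pinch x z y (s : I) : X :=
  if ival s == 2^-1 then z else if ival s <= 2^-1 then x else y.

(** For t < 1/2 the path is p, while for t >= 1/2 it is z at the parameter 1/2
and p slowed down by m on both sides, towards x on the left and towards y on the
right.  The jump of the slowed-down path at the parameter 1/2 is hidden by the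
value z, and the slit where z is taken is closed. *)
Lemma pinch_homotopy x y z (p : {path I from x to y in X}) :
  (forall s, below (p s) z) ->
  exists H : I * I -> X, [/\ continuous H, forall s, H (s, zero) = p s,
    forall s, H (s, one) = pinch x z y s &
    forall t, H (zero, t) = x /\ H (one, t) = y].
Proof.
move=> pz.
pose m (w : I * I) := Num.min 1 (2 - 2 * ival w.2) : R.
have cm : continuous m by cts.
pose kl (w : I * I) := p (clamp (ival w.1 * m w)).
pose kr (w : I * I) := p (clamp (1 - (1 - ival w.1) * m w)).
exists (fun w => if (ival w.1 == 2^-1) && (2^-1 <= ival w.2) then z
               else if ival w.1 <= 2^-1 then kl w else kr w).
have m0 w : ival w.2 <= 2^-1 -> m w = 1 by move=> w2; rewrite /m min_l //; lra.
split=> [|s|s|t] /=.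
- apply: (@below_continuous _ _ z) => [w|w].
    by case: ifP => _; [exact: below_refl|case: ifP => _; exact: pz].
  have ckl : continuous kl by apply: (comp_cts (k := p)); [exact: cts_fun|cts].
  have ckr : continuous kr by apply: (comp_cts (k := p)); [exact: cts_fun|cts].
  have c1 : continuous (fun w : I * I => ival w.1) by exact: ival1_cts.
  have c2 : continuous (fun w : I * I => ival w.2) by exact: ival2_cts.
  have [lt|gt|eq] := ltgtP (ival w.1) 2^-1 => /= hw.
  + exists kl; split=> //.
    have near1 : \near w, ival w.1 < 2^-1 := c1 w _ (lt_nbhsl lt).
    by apply: filterS near1 => v /= v1; rewrite (lt_eqF v1) /= (ltW v1).
  + exists kr; split=> //.
    have near1 : \near w, 2^-1 < ival w.1 := c1 w _ (lt_nbhsr gt).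
    by apply: filterS near1 => v /= v1; rewrite (gt_eqF v1) /= leNgt v1.
  + have w2 : ival w.2 < 2^-1 by rewrite ltNge; apply/negP => h; rewrite h in hw.
    exists (fun v => p (v.1)); split.
      by apply: (comp_cts (k := p)); [exact: cts_fun|exact: fst_cts].
    have near2 : \near w, ival w.2 < 2^-1 := c2 w _ (lt_nbhsl w2).
    apply: filterS near2 => v /= v2.
    rewrite (leNgt 2^-1) v2 andbF /kl /kr (m0 v (ltW v2)).
    by rewrite !mulr1 subKr ivalK; case: ifP.
- rewrite ival0 ifF; last by apply/negP => /andP[_]; lra.
  by rewrite /kl /kr m0 ?ival0 ?mulr1 ?subKr ?ivalK; [case: ifP|lra].
- have m1 : m (s, one) = 0 by rewrite /m /= ival1 min_r; lra.
  rewrite ival1 (_ : 2^-1 <= 1); last by lra.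
  rewrite andbT /pinch /kl /kr m1 !mulr0 subr0 -[clamp 0]/zero -[clamp 1]/one.
  by rewrite path_zero path_one.
- rewrite /kl /kr /= ival0 ival1 mul0r subrr mul0r subr0 -[clamp 0]/zero -[clamp 1]/one.
  rewrite path_zero path_one; split.
    rewrite ifF; last by apply/negP => /andP[/eqP]; lra.
    by rewrite ifT //; lra.
  rewrite ifF; last by apply/negP => /andP[/eqP]; lra.
  by rewrite ifF //; apply/negP; lra.
Qed.

(** Both paths are homotopic to the same pinched path through z. *)
Lemma homotopic_in_cone x y z (p q : {path I from x to y in X}) :
  (forall s, below (p s) z) -> (forall s, below (q s) z) -> path_homotopic p q.
Proof.
move=> /pinch_homotopy[H [cH H0 H1 He]] /pinch_homotopy[K [cK K0 K1 Ke]].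
have cw : continuous (pinch x z y).
  rewrite (_ : pinch x z y = fun s => H (s, one)); last by apply/funext => s; rewrite H1.
  apply: (comp_cts (k := H)) => //; apply: pair_cts; first by move=> s; exact: cvg_id.
  exact: cst_continuous.
have w0 : pinch x z y zero = x by rewrite -H1; have [] := He one.
have w1 : pinch x z y one = y by rewrite -H1; have [] := He one.
pose w : {path I from x to y in X} := mk_path cw w0 w1.
have pw : path_homotopic p w by exists H.
have qw : path_homotopic q w by exists K.
exact: path_homotopic_trans pw (path_homotopic_sym qw).
Qed.

End Cone.

(** * Loops in flat sets *)

Section Edge.
Context {R : realType} {X : topologicalType}.
Local Notation I := (unit_interval R).
Implicit Types x y z : X.

Lemma edge_cts x y : below x y ->
  continuous (fun s : I => if ival s == 1 then y else x).
Proof.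
move=> xy; apply: (@below_continuous _ _ _ y) => [s|s].
  by case: ifP => _; [exact: below_refl|exact: xy].
case: eqP => [//|/eqP s1] _; exists (fun=> x); split; first exact: cst_continuous.
have near1 : \near s, ival s < 1.
  apply: (ival_continuous (lt_nbhsl _)).
  by rewrite lt_neqAle s1; have /andP[] := ival_bounds s.
by apply: filterS near1 => v v1; rewrite (lt_eqF v1).
Qed.

Lemma edge0 x y : (if ival (zero : I) == 1 then y else x) = x.
Proof. by rewrite ival0 eq_sym oner_eq0. Qed.

Lemma edge1 x y : (if ival (one : I) == 1 then y else x) = y.
Proof. by rewrite ival1 eqxx. Qed.

Definition edge x y (xy : below x y) : {path I from x to y in X} :=
  mk_path (edge_cts xy) (edge0 x y) (edge1 x y).

Lemma edge_below x y (xy : below x y) s : below (edge xy s) y.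
Proof.
by rewrite /edge /= /mk_path; case: ifP => _; [exact: below_refl|exact: xy].
Qed.

Lemma cat_below x y z w (p : {path I from x to y in X})
    (q : {path I from y to z in X}) :
  (forall s, below (p s) w) -> (forall s, below (q s) w) ->
  forall s, below (path_cat p q s) w.
Proof. by move=> pw qw s; rewrite path_catE; case: ifP. Qed.

Variables (x0 : X) (gam : forall x, {path I from x0 to x in X}).

(** The value 1 when x is not below y is a dummy. *)
Definition transport x y : pi1 R x0 :=
  if pselect (below x y) is left xy then hol gam (edge xy) else 1%g.

Lemma hol_in_cone x y (p : {path I from x to y in X}) :
  (forall s, below (p s) y) -> hol gam p = transport x y.
Proof.
move=> py; rewrite /transport; case: pselect => [xy|[]].
  by apply: hol_homotopic; apply: homotopic_in_cone py (edge_below xy).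
by rewrite -[x](@path_zero _ _ _ _ p); exact: py.
Qed.

Lemma transportM x y z : below x y -> below y z ->
  (transport x y * transport y z = transport x z)%g.
Proof.
move=> xy yz; rewrite -(hol_in_cone (edge_below xy)) -(hol_in_cone (edge_below yz)).
rewrite -hol_cat; apply: hol_in_cone; apply: cat_below => s; last exact: edge_below.
exact: below_trans (edge_below xy s) yz.
Qed.

(** Parameters range over R rather than [0, 1], so that subpaths run between
arbitrary endpoints r and t and openness is stated with balls of R. *)
Section Subpath.
Variables (a b : X) (p : {path I from a to b in X}).

Let sub_fun (r t : R) (s : I) := p (clamp (r + ival s * (t - r))).

Lemma sub_cts r t : continuous (sub_fun r t).
Proof. by apply: (comp_cts (k := p)); [exact: cts_fun|cts]. Qed.

Lemma sub0 r t : sub_fun r t zero = p (clamp r).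
Proof. by rewrite /sub_fun ival0 mul0r addr0. Qed.

Lemma sub1 r t : sub_fun r t one = p (clamp t).
Proof. by rewrite /sub_fun ival1 mul1r subrKC. Qed.

Definition subpath r t : {path I from p (clamp r) to p (clamp t) in X} :=
  mk_path (@sub_cts r t) (sub0 r t) (sub1 r t).

Lemma subpathE r t s : subpath r t s = p (clamp (r + ival s * (t - r))).
Proof. by []. Qed.

Lemma subpath_cat r t u :
  path_homotopic (path_cat (subpath r t) (subpath t u)) (subpath r u).
Proof.
apply: (@homotopic_reparam _ _ _ _ (fun v => p (clamp v)) _ _
  (fun s => r + Num.min (2 * ival s) 1 * (t - r) +
            Num.max 0 (2 * ival s - 1) * (u - t))
  (fun s => r + ival s * (u - r))) => [||||| s|s].
- exact: clamp_path_cts.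
- by cts.
- by cts.
- by rewrite ival0 min_l ?max_l; lra.
- by rewrite ival1 min_r ?max_r; lra.
- have /andP[s0 s1] := ival_bounds s; rewrite /= path_catE !subpathE.
  case: leP => h; congr (p (clamp _)).
    rewrite clampK; last by apply/andP; split; lra.
    by rewrite min_l ?max_l; lra.
  rewrite clampK; last by apply/andP; split; lra.
  by rewrite min_r ?max_r; lra.
- by [].
Qed.

Lemma hol_subpathM r t u :
  (hol gam (subpath r t) * hol gam (subpath t u) = hol gam (subpath r u))%g.
Proof. by rewrite -hol_cat; apply/hol_homotopic/subpath_cat. Qed.

Lemma hol_subpath_id r : hol gam (subpath r r) = 1%g.
Proof.
rewrite -(hol_cst gam (p (clamp r))); apply: hol_eq => // s.
by rewrite subpathE subrr mulr0 addr0.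
Qed.

Lemma hol_subpath01 : hol gam (subpath 0 1) = hol gam p.
Proof.
apply: hol_eq => [||s]; [exact: path_zero|exact: path_one|].
by rewrite subpathE add0r subr0 mulr1 ivalK.
Qed.

Hypothesis alexX : alexandroff_space X.

(** In an Alexandroff space the points below p (clamp r0) are its least open
neighbourhood. *)
Lemma near_below (r0 : R) : exists2 e, 0 < e &
  forall r, `|r0 - r| < e -> below (p (clamp r)) (p (clamp r0)).
Proof.
pose U := \bigcap_(V in [set V : set X | open V /\ V (p (clamp r0))]) V.
have oU : open U by apply: alexX => V [].
have : nbhs r0 ((fun r => p (clamp r)) @^-1` U).
  apply: (@clamp_path_cts R X _ _ p r0); apply: open_nbhs_nbhs; split=> //.
  by move=> V [].
move=> /nbhs_ballP[e /= e0 eU]; exists e => // r rr0 V oV Vr0.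
by apply: (eU r rr0 V); split.
Qed.

(** Let T be the set of times r up to which the holonomy of p is given by f.
Near any r0 the path stays below its value at r0, so by [hol_in_cone] the
holonomy between r and r0 is one value of [transport], which f trivializes:
r is in T exactly when r0 is.  Thus T is open and closed in the connected line,
and contains 0. *)
Lemma hol_flat (A : set X) (f : X -> pi1 R x0) :
  (forall x y, A x -> A y -> below x y -> (f x * transport x y = f y)%g) ->
  (forall s, A (p s)) -> (f a * hol gam p = f b)%g.
Proof.
move=> fA pA; pose T := [set r : R |
  (f (p (clamp 0)) * hol gam (subpath 0 r) = f (p (clamp r)))%g].
have loc r0 : exists2 e, 0 < e & forall r, `|r0 - r| < e -> T r <-> T r0.
  have [e e0 eP] := near_below r0; exists e => // r rr0.
  have := hol_subpathM 0 r r0; rewrite (@hol_in_cone _ _ (subpath r r0)); last first.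
    move=> s; rewrite subpathE; apply: eP.
    rewrite (_ : r0 - _ = (1 - ival s) * (r0 - r)); last lra.
    have /andP[s0 s1] := ival_bounds s.
    rewrite normrM ger0_norm ?subr_ge0 //; apply: le_lt_trans rr0.
    by rewrite ler_piMl // lerBlDr lerDl.
  have step := fA _ _ (pA (clamp r)) (pA (clamp r0)) (eP r rr0).
  move=> eqh; rewrite /T /= -eqh -step mulgA; split=> [->//|].
  exact: mulIg.
have openT : open T.
  rewrite openE => r Tr; have [e e0 eP] := loc r.
  by apply/nbhs_ballP; exists e => //= t /eP/iffRL; exact.
have closedT : open (~` T).
  rewrite openE => r Tr; have [e e0 eP] := loc r.
  by apply/nbhs_ballP; exists e => //= t /eP/iffLR h /h.
have TT : T = setT.
  have conn : connected [set: R].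
    by apply/connected_intervalP => ? ? _ _ ? _.
  apply: conn.
  - exists 0; rewrite /T /= hol_subpath_id; exact: mulg1.
  - by exists T => //; rewrite setTI.
  - by exists T; rewrite ?setTI // -openC.
have : T 1 by rewrite TT.
rewrite /T /= hol_subpath01 -[clamp 0]/zero -[clamp 1]/one.
by rewrite path_zero path_one.
Qed.

End Subpath.
End Edge.

(** * Finite spaces *)

(** An intersection of open sets is already obtained by choosing, for each of the
finitely many points outside it, one of the sets which misses that point. *)
Lemma finite_alexandroff (X : topologicalType) :
  finite_set [set: X] -> alexandroff_space X.
Proof.
move=> finX F Fopen; set G := \bigcap_(U in F) U; rewrite openE => x Gx.
pose f y := if pselect (exists2 V, F V & ~ V y) is left h
            then projT1 (cid2 h) else setT.
have fx y : nbhs x (f y).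
  rewrite /f; case: pselect => [h|_]; last exact: filterT.
  case: cid2 => V /= FV _; apply: open_nbhs_nbhs; split; first exact: Fopen.
  exact: Gx.
have : nbhs x (\bigcap_(y in [set` fset_set [set: X]]) f y).
  by apply: filter_bigI => y _; exact: fx.
apply: filterS => v fv V FV; apply: contrapT => nVv.
have : f v v by apply: fv; rewrite /= in_fset_set // inE.
by rewrite /f; case: pselect => [h|[]]; [case: cid2|exists V].
Qed.

(** The points reached from x0 form a clopen set, since the points below y are an
open neighbourhood of y and are joined to y by [edge]. *)
Lemma connected_paths (R : realType) (X : topologicalType) (x0 : X) :
  alexandroff_space X -> connected [set: X] ->
  forall x, $| {path (unit_interval R) from x0 to x in X} |.
Proof.
move=> alexX conn; pose S := [set x | $| {path (unit_interval R) from x0 to x in X} |].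
have openbelow (y : X) : open [set x | below x y].
  rewrite (_ : mkset _ = \bigcap_(V in [set V : set X | open V /\ V y]) V).
    by apply: alexX => V [].
  by apply/seteqP; split=> x xy V; [case; exact: xy|move=> oV Vy; exact: xy].
suff ST : S = setT by move=> x; have : S x by rewrite ST.
apply: conn; first by exists x0; squash (cst x0 : {path (unit_interval R) from x0 to x0 in X}).
- exists S; rewrite ?setTI // openE => y [p].
  apply: filterS (open_nbhs_nbhs (conj (openbelow y) (below_refl (x := y)))).
  by move=> x xy; squash (path_cat p (path_rev (edge xy))).
- exists S; rewrite ?setTI // -openC openE => y nSy.
  apply: filterS (open_nbhs_nbhs (conj (openbelow y) (below_refl (x := y)))).
  by move=> x xy [p]; apply: nSy; squash (path_cat p (edge xy)).
Qed.

(** A loop at a has holonomy h with f a * h = f a by [hol_flat]. *)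
Lemma flat_components_trivial (R : realType) (X : topologicalType) (x0 : X)
    (gam : forall x, {path (unit_interval R) from x0 to x in X})
    (A : set X) (f : X -> pi1 R x0) :
  alexandroff_space X ->
  (forall x y, A x -> A y -> below x y -> (f x * transport gam x y = f y)%g) ->
  components_pi1_trivial R A.
Proof.
move=> alexX fA x Ax a c; apply/loop_classP; apply: (hol_inj (gam := gam)).
apply: (mulgI (f (inclusion a))); rewrite mulg1.
apply: (hol_flat alexX fA) => s /=.
exact: connected_component_sub (set_valP (repr c s)).
Qed.

Theorem theorem5p6 (R : realType) (X : topologicalType)
    (finX : finite_set [set: X])
    (conX : connected_space X)
    (T0X : kolmogorov_space X)
    (noTriad : ~ exists C D : set X,
      splitting_triad R C D /\ components_pi1_trivial R C) :
  (13 <= #|` fset_set [set: X]|)%N.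
Proof.
rewrite ltnNge; apply/negP => le12; apply: noTriad.
have alexX := finite_alexandroff finX.
have [[x0 _] conn] := conX.
have gam x : {path (unit_interval R) from x0 to x in X}.
  exact: unsquash (connected_paths R x0 alexX conn x).
pose T : finType := fset_set [set: X].
have inT x : x \in fset_set [set: X] by rewrite in_fset_set // inE.
pose toT x : T := [` inT x]%fset.
pose le (u v : T) := `[< below (val u) (val v) >].
pose g (u v : T) := transport gam (val u) (val v).
have leg : cocycle le g.
  split=> [u|u v|v u w|u v w].
  - by apply/asboolP; exact: below_refl.
  - case/andP=> /asboolP uv /asboolP vu; apply/val_inj/eqP/negP => /negP neq.
    have sep (a b : X) : below b a -> forall V, ~ (V \in nbhs a /\ b \in ~` V).
      move=> ba V [/set_mem + /set_mem]; rewrite nbhsE /= => -[U [oU Ua] UV]; apply.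
      by apply: UV; exact: ba oU Ua.
    by have [V [/(sep _ _ vu)|/(sep _ _ uv)]] := T0X _ _ neq.
  - by move=> /asboolP uv /asboolP vw; apply/asboolP; exact: below_trans uv vw.
  - by move=> /asboolP uv /asboolP vw; exact: transportM.
have [|A [B [cov [fA fAP] [fB fBP]]]] := @small_splits T _ le g [set: T]%SET leg.
  by rewrite cardsT -cardfE.
have triv (E : {set T}) (f : T -> pi1 R x0) :
    {in E &, forall u v, le u v -> (f u * g u v = f v)%g} ->
    components_pi1_trivial R [set x | toT x \in E].
  move=> fE; apply: (@flat_components_trivial _ _ x0 gam _ (f \o toT)) => // x y.
  by move=> xE yE xy; apply: (fE (toT x) (toT y)) => //; apply/asboolP.
have cover : [set: X] = [set x | toT x \in A] `|` [set x | toT x \in B].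
  apply/seteqP; split=> // x _; have : toT x \in A :|: B by apply: (fintype.subsetP cov); rewrite finset.in_setT.
  by case/finset.setUP; [left|right].
have triad (C D : set X) : [set: X] = C `|` D -> C !=set0 -> D !=set0 ->
    components_pi1_trivial R C -> components_pi1_trivial R D ->
    exists C D : set X, splitting_triad R C D /\ components_pi1_trivial R C.
  by move=> CD C0 D0 trivC trivD; exists C, D.
(* a triad needs two non-empty sets: if one of them is empty, take X twice *)
have [A0|/set0P A0] := eqVneq [set x | toT x \in A] set0.
  have BT : [set x | toT x \in B] = setT by rewrite cover A0 set0U.
  apply: (triad setT setT); rewrite ?setTU //; try by exists x0.
  - by rewrite -BT; apply: triv fBP.
  - by rewrite -BT; apply: triv fBP.
have [B0|/set0P B0] := eqVneq [set x | toT x \in B] set0.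
  have AT : [set x | toT x \in A] = setT by rewrite cover B0 setU0.
  apply: (triad setT setT); rewrite ?setTU //; try by exists x0.
  - by rewrite -AT; apply: triv fAP.
  - by rewrite -AT; apply: triv fAP.
exact: triad cover A0 B0 (triv _ _ fAP) (triv _ _ fBP).
Qed.
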